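(* Let $\mathcal N$ be an integrable field of totally null 2-planes on a 4-dimensional manifold $(\mathcal M,g)$ with a metric $g$, let $\check\nabla$ be its characteristic connection, and let $(m,p,n,k)$ be a null frame adapted to $\mathcal N$. Then $\check\nabla$ is torsionless, $\check T\equiv 0$, and its curvature $\check R$ is given by $$\check R(m,k)m=4\Psi_1\,m,\qquad \check R(m,k)k=4\Psi_1\,k,$$ where $\Psi_1=C(m,k,n,k)$ is a component of the Weyl tensor $C$ of $g$.
   Context: $g$ is a complex-valued metric (a nondegenerate symmetric complex bilinear form on ${\rm T}^{\mathbb C}\mathcal M$; real metrics of any signature are included). A field of totally null 2-planes is a complex rank-2 subbundle $\mathcal N\subset{\rm T}^{\mathbb C}\mathcal M$ with $g_{|\mathcal N}\equiv0$; integrable means $[\mathcal N,\mathcal N]\subset\mathcal N$. A null frame adapted to $\mathcal N$ is a local frame $(e_1,e_2,e_3,e_4)=(m,p,n,k)$ with $g(m,p)=g(n,k)=1$, all other products of frame vectors zero, and $\mathcal N={\rm Span}_{\mathbb C}(m,k)$. Characteristic connection: when $\mathcal N$ is integrable there exist (locally) torsionless complex connections $\nabla^W$ with $\nabla^Wg=-B\otimes g$ for some complex 1-form $B$ and $\nabla^W_YX\in\mathcal N$ for all $X\in\mathcal N$, $Y\in{\rm T}\mathcal M$; all of them restrict to one and the same partial connection $\check\nabla$ on $\mathcal N$, $\check\nabla_XY=\nabla^W_XY$ for $X,Y\in\mathcal N$, called the characteristic connection of $\mathcal N$. (In an adapted frame, with Levi-Civita coefficients $\nabla_{e_c}e_b=\Gamma^a{}_{bc}e_a$,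 $\Gamma_{abc}=g_{ad}\Gamma^d{}_{bc}$, one has $B(m)=2\Gamma_{143}$, $B(k)=-2\Gamma_{142}$, the other components of $B$ being arbitrary.) Its torsion and curvature are, for $X,Y,Z\in\mathcal N$, $\check T(X,Y)=\check\nabla_XY-\check\nabla_YX-[X,Y]$ and $\check R(X,Y)Z=\check\nabla_X\check\nabla_YZ-\check\nabla_Y\check\nabla_XZ-\check\nabla_{[X,Y]}Z$. Weyl tensor conventions: $R(e_c,e_d)e_b=R^a{}_{bcd}e_a$ for the Levi-Civita connection, $R_{ab}=R^c{}_{acb}$, $R=g^{ab}R_{ab}$, $\mathsf P_{ab}=\tfrac12R_{ab}-\tfrac1{12}Rg_{ab}$, $C_{abcd}=R_{abcd}+g_{ad}\mathsf P_{cb}-g_{ac}\mathsf P_{db}+g_{bc}\mathsf P_{da}-g_{bd}\mathsf P_{ca}$, and $C(m,k,n,k)=C_{1434}$. *)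

(* Defs.v *)
From HB Require Import structures.
From mathcomp Require Import all_boot all_order all_algebra.
From mathcomp Require Import all_classical all_reals all_analysis.
From mathcomp Require Export complex.
Set Implicit Arguments.
Unset Strict Implicit.
Unset Printing Implicit Defensive.
Import Order.TTheory GRing.Theory Num.Theory.
Import numFieldNormedType.Exports.
Local Open Scope classical_set_scope.
Local Open Scope ring_scope.

(* C^k functions on an open subset of R^4, by iterated partial derivatives. *)
Fixpoint Ck (R : realType) (k : nat) (U : set 'rV[R]_4) (f : 'rV[R]_4 -> R) :
    Prop :=
  (forall x, U x -> {for x, continuous f}) /\
  if k is k'.+1 then
    forall i : 'I_4, (forall x, U x -> derivable f x (delta_mx 0 i)) /\
                     Ck k' U (fun x => 'D_(delta_mx 0 i) f x)
  else True.

Definition smoothR (R : realType) (U : set 'rV[R]_4) (f : 'rV[R]_4 -> R) :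
  Prop := forall k, Ck k U f.

(* Only the restrictions of [cmap] to [cdom] and of [cinv] to the image of
   [cdom] are meaningful. *)
Record chart (R : realType) (M : topologicalType) := Chart {
  cdom : set M;
  cmap : M -> 'rV[R]_4;
  cinv : 'rV[R]_4 -> M }.

Definition is_chart (R : realType) (M : topologicalType) (c : chart R M) :
  Prop :=
  [/\ open (cdom c),
      open (cmap c @` cdom c),
      forall x, cdom c x -> {for x, continuous (cmap c)},
      forall y, (cmap c @` cdom c) y -> {for y, continuous (cinv c)}
    & forall x, cdom c x -> cinv c (cmap c x) = x].

Definition compatible (R : realType) (M : topologicalType) (c c' : chart R M) :
  Prop :=
  forall i : 'I_4,
    smoothR (cmap c @` (cdom c `&` cdom c')) (fun y => cmap c' (cinv c y) 0 i).

Record manifold4 (R : realType) := Manifold4 {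
  mspace :> topologicalType;
  atlas : set (chart R mspace);
  manifold_hausdorff : hausdorff_space mspace;
  manifold_second_countable : @second_countable mspace;
  atlas_chart : forall c, atlas c -> is_chart c;
  atlas_compatible : forall c c', atlas c -> atlas c' -> compatible c c';
  atlas_cover : forall x : mspace, exists2 c, atlas c & cdom c x }.

Section Manifold.
Context {R : realType} {M : manifold4 R}.
Local Notation C := R[i].

Definition smooth (U : set M) (f : M -> C) : Prop :=
  forall c, atlas c ->
    smoothR (cmap c @` (U `&` cdom c)) (fun y => complex.Re (f (cinv c y))) /\
    smoothR (cmap c @` (U `&` cdom c)) (fun y => complex.Im (f (cinv c y))).

Definition smooth_at (x : M) (f : M -> C) : Prop :=
  exists U : set M, [/\ open U, U x & smooth U f].

(* Complex tangent vectors at x are the C-linear derivations, at x, of the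
   algebra of germs of smooth complex-valued functions.  They are encoded as
   functionals on all functions; the first condition of [tangent] fixes the
   irrelevant values, so that equality of functionals is equality of
   derivations. *)
Definition tvec : Type := (M -> C) -> C^o.

Definition tangent (x : M) : set tvec := [set v |
  [/\ forall f, ~ smooth_at x f -> v f = 0,
      forall f h, smooth_at x f -> (\forall y \near x, f y = h y) -> v f = v h,
      forall (a : C) f h, smooth_at x f -> smooth_at x h ->
        v (fun y => a * f y + h y) = a * v f + v h
    & forall f h, smooth_at x f -> smooth_at x h ->
        v (fun y => f y * h y) = f x * v h + h x * v f] ].

(* Fields are total functions, of which only the restriction to the open set
   under consideration is meaningful. *)
Definition vfield : Type := M -> tvec.

Definition act (X : vfield) (f : M -> C) : M -> C := fun x => X x f.

Definition vector_field (U : set M) (X : vfield) : Prop :=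
  (forall x, U x -> tangent x (X x)) /\
  (forall (V : set M) f, open V -> smooth V f -> smooth (U `&` V) (act X f)).

Definition bracket (X Y : vfield) : vfield := fun x f =>
  if `[< smooth_at x f >] then X x (act Y f) - Y x (act X f) else 0.

Definition section (D : M -> set tvec) (U : set M) (X : vfield) : Prop :=
  vector_field U X /\ forall x, U x -> D x (X x).

Definition span2 (u v : tvec) : set tvec :=
  [set w | exists a b : C, w = a *: u + b *: v].

Definition rank2_subbundle (N : M -> set tvec) : Prop :=
  forall x, exists (U : set M) (X Y : vfield),
    [/\ open U, U x, vector_field U X, vector_field U Y &
        forall y, U y ->
          N y = span2 (X y) (Y y) /\
          forall a b : C, a *: X y + b *: Y y = 0 -> a = 0 /\ b = 0].

Definition integrable_field (N : M -> set tvec) : Prop :=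
  forall (U : set M) (X Y : vfield), open U ->
    section N U X -> section N U Y -> section N U (bracket X Y).

Definition local_frame (U : set M) (e : 'I_4 -> vfield) : Prop :=
  (forall a, vector_field U (e a)) /\
  forall x, U x ->
    (forall v, tangent x v ->
       exists c : 'I_4 -> C, v = \sum_(a < 4) c a *: e a x) /\
    (forall c : 'I_4 -> C,
       \sum_(a < 4) c a *: e a x = 0 -> forall a, c a = 0).

Definition bilinear_form : Type := M -> tvec -> tvec -> C.

Definition ip (g : bilinear_form) (X Y : vfield) : M -> C :=
  fun x => g x (X x) (Y x).

Definition metric (g : bilinear_form) : Prop :=
  [/\ forall x (a : C) u v w, tangent x u -> tangent x v -> tangent x w ->
        g x (a *: u + v) w = a * g x u w + g x v w,
      forall x u v, tangent x u -> tangent x v -> g x u v = g x v u,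
      forall x u, tangent x u ->
        (forall v, tangent x v -> g x u v = 0) -> u = 0
    & forall (U : set M) X Y, open U -> vector_field U X -> vector_field U Y ->
        smooth U (ip g X Y)].

Definition totally_null (g : bilinear_form) (N : M -> set tvec) : Prop :=
  forall x u v, N x u -> N x v -> g x u v = 0.

Definition one_form (U : set M) (B : M -> tvec -> C) : Prop :=
  (forall x (a : C) u v, U x -> tangent x u -> tangent x v ->
     B x (a *: u + v) = a * B x u + B x v) /\
  (forall (V : set M) X, open V -> V `<=` U -> vector_field V X ->
     smooth V (fun x => B x (X x))).

(* Connection over U on the bundle E along the distribution D, acting on
   local sections; D = E = [tangent] gives the affine connections, and
   D = E = N the partial connections on N. *)
Definition connection (U : set M) (D E : M -> set tvec)
    (nabla : vfield -> vfield -> vfield) : Prop :=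
  forall V : set M, open V -> V `<=` U ->
  [/\ forall X Y, section D V X -> section E V Y -> section E V (nabla X Y),
      forall X X' Y Y', section D V X -> section E V Y ->
        (forall x, V x -> X x = X' x) -> (forall x, V x -> Y x = Y' x) ->
        forall x, V x -> nabla X Y x = nabla X' Y' x,
      forall f X X' Y, smooth V f -> section D V X -> section D V X' ->
        section E V Y -> forall x, V x ->
        nabla (fun y => f y *: X y + X' y) Y x
          = f x *: nabla X Y x + nabla X' Y x
    & forall f X Y Y', smooth V f -> section D V X -> section E V Y ->
        section E V Y' -> forall x, V x ->
        nabla X (fun y => f y *: Y y + Y' y) x
          = act X f x *: Y x + f x *: nabla X Y x + nabla X Y' x].

Definition torsion (nabla : vfield -> vfield -> vfield) (X Y : vfield) :
  vfield := fun x => nabla X Y x - nabla Y X x - bracket X Y x.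

Definition curvature (nabla : vfield -> vfield -> vfield) (X Y Z : vfield) :
  vfield := fun x =>
    nabla X (nabla Y Z) x - nabla Y (nabla X Z) x - nabla (bracket X Y) Z x.

Definition torsionless (U : set M) (D : M -> set tvec)
    (nabla : vfield -> vfield -> vfield) : Prop :=
  forall (V : set M) X Y, open V -> V `<=` U ->
    section D V X -> section D V Y ->
    forall x, V x -> torsion nabla X Y x = 0.

(* (nabla_X g)(Y, Z) *)
Definition deriv_metric (nabla : vfield -> vfield -> vfield)
    (g : bilinear_form) (X Y Z : vfield) : M -> C :=
  fun x => act X (ip g Y Z) x - ip g (nabla X Y) Z x - ip g Y (nabla X Z) x.

Definition levi_civita (g : bilinear_form)
    (nabla : vfield -> vfield -> vfield) : Prop :=
  [/\ connection setT tangent tangent nabla,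
      torsionless setT tangent nabla
    & forall (V : set M) X Y Z, open V ->
        vector_field V X -> vector_field V Y -> vector_field V Z ->
        forall x, V x -> deriv_metric nabla g X Y Z x = 0].

Definition weyl_connection (g : bilinear_form) (U : set M)
    (B : M -> tvec -> C) (nabla : vfield -> vfield -> vfield) : Prop :=
  [/\ connection U tangent tangent nabla,
      torsionless U tangent nabla
    & forall (V : set M) X Y Z, open V -> V `<=` U ->
        vector_field V X -> vector_field V Y -> vector_field V Z ->
        forall x, V x ->
          deriv_metric nabla g X Y Z x = - (B x (X x) * ip g Y Z x)].

Definition preserves (U : set M) (N : M -> set tvec)
    (nabla : vfield -> vfield -> vfield) : Prop :=
  forall (V : set M) X Y, open V -> V `<=` U ->
    section N V X -> vector_field V Y -> section N V (nabla Y X).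

(* The Weyl connections are only required to exist locally. *)
Definition characteristic_connection (g : bilinear_form) (N : M -> set tvec)
    (cnabla : vfield -> vfield -> vfield) : Prop :=
  connection setT N N cnabla /\
  forall x : M, exists (U : set M) (B : M -> tvec -> C)
                       (nablaW : vfield -> vfield -> vfield),
    [/\ open U /\ U x,
        one_form U B,
        weyl_connection g U B nablaW,
        preserves U N nablaW
      & forall (V : set M) X Y, open V -> V `<=` U ->
          section N V X -> section N V Y ->
          forall y, V y -> cnabla X Y y = nablaW X Y y].

Definition frame4 (m p n k : vfield) : 'I_4 -> vfield :=
  tnth [tuple m; p; n; k].

Definition adapted_null_frame (g : bilinear_form) (N : M -> set tvec)
    (U : set M) (m p n k : vfield) : Prop :=
  local_frame U (frame4 m p n k) /\
  forall x, U x ->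
    [/\ ip g m p x = 1 /\ ip g n k x = 1,
        [/\ ip g m m x = 0, ip g p p x = 0, ip g n n x = 0 & ip g k k x = 0],
        [/\ ip g m n x = 0, ip g m k x = 0, ip g p n x = 0 & ip g p k x = 0]
      & N x = span2 (m x) (k x)].

Section Weyl.
(* [nabla] is the Levi-Civita connection of [g], and traces are computed in
   the local frame [e]. *)
Variables (g : bilinear_form) (nabla : vfield -> vfield -> vfield).
Variable e : 'I_4 -> vfield.

Definition ginv (x : M) : 'M[C]_4 :=
  invmx (\matrix_(a, b) ip g (e a) (e b) x).

(* R_{abcd} = [riem] e_a e_b e_c e_d: the first index is the lowered one, the
   last two are the 2-form indices. *)
Definition riem (X Y Z W : vfield) : M -> C :=
  ip g X (curvature nabla Z W Y).

(* R_{ab} = R^c_{acb} = g^{cd} R_{dacb} *)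
Definition ricci (X Y : vfield) (x : M) : C :=
  \sum_(c < 4) \sum_(d < 4) ginv x c d * riem (e d) X (e c) Y x.

Definition scalar_curvature (x : M) : C :=
  \sum_(a < 4) \sum_(b < 4) ginv x a b * ricci (e a) (e b) x.

Definition schouten (X Y : vfield) (x : M) : C :=
  2^-1 * ricci X Y x - 12^-1 * scalar_curvature x * ip g X Y x.

(* C_{abcd} = [weyl] e_a e_b e_c e_d *)
Definition weyl (X Y Z W : vfield) (x : M) : C :=
  riem X Y Z W x
  + ip g X W x * schouten Z Y x - ip g X Z x * schouten W Y x
  + ip g Y Z x * schouten W X x - ip g Y W x * schouten Z X x.

End Weyl.
End Manifold.

Arguments tvec {R} M.
Arguments vfield {R} M.
Arguments bilinear_form {R} M.

(* Main.v *)
(** Write [b] for half of the form [B] of a Weyl connection preserving [N], and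
    number [(m, p, n, k)] as [(1, 2, 3, 4)].  By Koszul's argument such a
    connection differs from the Levi-Civita connection by
    [b(X) Y + b(Y) X - g(X, Y) b#]; the last term vanishes on [N], so the
    curvature of the characteristic connection is that of Levi-Civita plus
    derivatives of [b(m)] and [b(k)].  Invariance of [N], on the other hand,
    gives [g(nabla_Y m, k) = b(k) g(Y, m) - b(m) g(Y, k)] for every [Y], which
    expresses [R_4121], [R_4131] and [R_4134] through the same derivatives.
    They cancel against [2 C_1434 = R_1434 + R_2114], the trace part of the Weyl
    tensor being [P_41 = (R_2114 - R_1434) / 2].  The action on [k] follows from
    that on [m] by the exchange [m <-> k], [p <-> n]. *)

Require Import Defs.
From mathcomp Require Import all_boot all_order all_algebra.
From mathcomp Require Import all_classical all_reals all_analysis.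
From mathcomp Require Import ring.
Set Implicit Arguments.
Unset Strict Implicit.
Unset Printing Implicit Defensive.
Import Order.TTheory GRing.Theory Num.Theory.
Import numFieldNormedType.Exports.
Local Open Scope classical_set_scope.
Local Open Scope ring_scope.

(** * Smooth functions *)

Section CkTheory.
Context {R : realType}.
Implicit Types (k : nat) (U V : set 'rV[R]_4) (f h : 'rV[R]_4 -> R).

Lemma Ck_sub k U V f : V `<=` U -> Ck k U f -> Ck k V f.
Proof.
elim: k f => [|k IHk] f VU /= [fc fd]; split => //.
- by move=> x /VU /fc.
- by move=> x /VU /fc.
- move=> i; have [fd1 fd2] := fd i; split; last exact: IHk.
  by move=> x /VU /fd1.
Qed.

(** Since [U] is open, the two functions agree near each of its points and so have the same partial
    derivatives there. This makes values outside [U] irrelevant. *)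
Lemma Ck_eq k U f h :
  open U -> (forall x, U x -> f x = h x) -> Ck k U f -> Ck k U h.
Proof.
move=> oU; elim: k f h => [|k IHk] f h fh /= [fc fd].
all: have fhN x : U x -> \forall y \near x, f y = h y by
  move=> Ux; apply: (filterS fh); exact: open_nbhs_nbhs.
all: have hc x : U x -> {for x, continuous h} by
  move=> Ux; rewrite /prop_for /continuous_at -fh//;
  exact: cvg_trans (near_eq_cvg (fhN x Ux)) (fc x Ux).
  by split.
split => // i; have [fd1 fd2] := fd i; split.
  by move=> x Ux; apply: near_eq_derivable (fd1 _ Ux); exact: fhN.
apply: IHk fd2 => x Ux; exact/near_eq_derive/fhN.
Qed.

Lemma CkW k U f : Ck k.+1 U f -> Ck k U f.
Proof.
elim: k f => [|k IHk] f [fc fd]; split => // i.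
by have [fd1 fd2] := fd i; split=> //; exact: IHk.
Qed.

Lemma Ck_cst k U (c : R) : Ck k U (fun=> c).
Proof.
elim: k c => [|k IHk] c; split => //=; try by move=> x _; exact: cst_continuous.
move=> i; split; first by move=> x _; exact: derivable_cst.
have -> : (fun x : 'rV[R]_4 => 'D_(delta_mx 0 i) (fun=> c) x) = fun=> 0.
  by apply/funext => x; exact: derive_cst.
exact: IHk.
Qed.

Lemma CkD k U f h : open U -> Ck k U f -> Ck k U h -> Ck k U (fun x => f x + h x).
Proof.
move=> oU; elim: k f h => [|k IHk] f h [fc fd] [hc hd].
all: have c x : U x -> {for x, continuous (fun x => f x + h x)} by
  move=> Ux; exact: cvgD (fc _ Ux) (hc _ Ux).
  by split.
split => // i; have [fd1 fd2] := fd i; have [hd1 hd2] := hd i; split.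
  move=> x Ux; exact: derivableD (fd1 _ Ux) (hd1 _ Ux).
apply: (Ck_eq oU _ (IHk _ _ fd2 hd2)) => x Ux.
by rewrite -(deriveD (fd1 _ Ux) (hd1 _ Ux)).
Qed.

(** By the Leibniz rule, each partial derivative pairs one factor, still of class [k] by [CkW], with
    a derivative of the other. *)
Lemma CkM k U f h : open U -> Ck k U f -> Ck k U h -> Ck k U (fun x => f x * h x).
Proof.
move=> oU; elim: k f h => [|k IHk] f h fk hk.
all: have c x : U x -> {for x, continuous (fun x => f x * h x)} by
  move=> Ux; exact: cvgM (fk.1 _ Ux) (hk.1 _ Ux).
  by split.
split => // i; have [fd1 fd2] := fk.2 i; have [hd1 hd2] := hk.2 i; split.
  move=> x Ux; exact: derivableM (fd1 _ Ux) (hd1 _ Ux).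
apply: (Ck_eq oU _ (CkD oU (IHk _ _ (CkW fk) hd2) (IHk _ _ (CkW hk) fd2))).
by move=> x Ux; rewrite [RHS](deriveM (fd1 _ Ux) (hd1 _ Ux)).
Qed.

End CkTheory.

(** * Algebra of complex-valued smooth functions on open sets *)

Section SmoothTheory.
Context {R : realType} {M : manifold4 R}.
Local Notation C := R[i].
Implicit Types (U V : set M) (f h : M -> C).

(** Inside the open image of the chart domain, this set is the preimage of [U] under [cinv], which
    is continuous at every point of that image. *)
Lemma open_chart_image (c : chart R M) U :
  atlas c -> open U -> open (cmap c @` (U `&` cdom c)).
Proof.
move=> /atlas_chart[oc oi cc ci cK] oU.
rewrite openE => _ [x [Ux cx] <-] /=.
have ix : (cmap c @` cdom c) (cmap c x) by exists x.
have := ci _ ix; rewrite /prop_for /continuous_at cK//.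
have oUc : nbhs x (U `&` cdom c).
  by apply: open_nbhs_nbhs; split => //; exact: openI.
move=> /(_ _ oUc) /= H.
have iN : nbhs (cmap c x) (cmap c @` cdom c) by exact: open_nbhs_nbhs.
rewrite /interior; apply: filterS2 iN H.
by move=> _ [y cy <-] /=; rewrite cK// => Uy; exists y.
Qed.

Lemma smooth_sub U V f : V `<=` U -> smooth U f -> smooth V f.
Proof.
move=> VU fU c ac; have [f1 f2] := fU c ac.
by split=> k; [move: (f1 k)|move: (f2 k)]; apply: Ck_sub;
  apply: image_subset => x [/VU].
Qed.

Lemma smooth_eq U f h :
  open U -> (forall x, U x -> f x = h x) -> smooth U f -> smooth U h.
Proof.
move=> oU fh fU c ac; have [f1 f2] := fU c ac.
have [_ _ _ _ cK] := atlas_chart ac.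
by split=> k; [move: (f1 k)|move: (f2 k)]; apply: Ck_eq;
  [exact: open_chart_image| |exact: open_chart_image|];
  move=> _ [x [Ux cx] <-]; rewrite cK// fh.
Qed.

Lemma smooth_cst U (a : C) : smooth U (fun=> a).
Proof. by move=> c ac; split=> k; exact: Ck_cst. Qed.

Lemma smoothD U f h :
  open U -> smooth U f -> smooth U h -> smooth U (fun x => f x + h x).
Proof.
move=> oU fU hU c ac; have [f1 f2] := fU c ac; have [h1 h2] := hU c ac.
have oc := open_chart_image ac oU.
split=> k; [apply: Ck_eq (CkD oc (f1 k) (h1 k))|
            apply: Ck_eq (CkD oc (f2 k) (h2 k))] => //.
all: by move=> y _; case: (f _) => ? ?; case: (h _) => ? ?.
Qed.

Lemma smoothM U f h :
  open U -> smooth U f -> smooth U h -> smooth U (fun x => f x * h x).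
Proof.
move=> oU fU hU c ac; have [f1 f2] := fU c ac; have [h1 h2] := hU c ac.
have oc := open_chart_image ac oU.
split=> k.
  (* The real part is [Re f * Re h - Im f * Im h], with the minus sign supplied by the constant [-1]
     so that closure under sums and products applies. *)
  apply: Ck_eq (CkD oc (CkM oc (f1 k) (h1 k))
     (CkM oc (Ck_cst k _ (-1)) (CkM oc (f2 k) (h2 k)))) => //.
  by move=> y _; case: (f _) => ? ?; case: (h _) => ? ? /=; ring.
apply: Ck_eq (CkD oc (CkM oc (f1 k) (h2 k)) (CkM oc (f2 k) (h1 k))) => //.
by move=> y _; case: (f _) => ? ?; case: (h _) => ? ? /=; ring.
Qed.

Lemma smoothB U f h :
  open U -> smooth U f -> smooth U h -> smooth U (fun x => f x - h x).
Proof.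
move=> oU fU hU.
apply: smooth_eq (smoothD oU fU (smoothM oU (smooth_cst U (-1)) hU)) => //.
by move=> x _; rewrite mulN1r.
Qed.

End SmoothTheory.

(** * Tangent vectors and vector fields *)

(* [ring] takes no hypotheses: this turns [a = b] from [c = d] into an identity. *)
Lemma transfer_eq (V : zmodType) (a b c d : V) : c = d -> a - b = c - d -> a = b.
Proof. by move=> -> /eqP; rewrite subrr subr_eq0 => /eqP. Qed.

Lemma self_opp (C : numDomainType) (a : C) : a = - a -> a = 0.
Proof. by move=> /eqP; rewrite -addr_eq0 -mulr2n mulrn_eq0 => /eqP. Qed.

Section VectorFields.
Context {R : realType} {M : manifold4 R}.
Local Notation C := R[i].
Implicit Types (x : M) (U V : set M) (f h : M -> C) (u v w : tvec M).
Implicit Types (X Y Z W : vfield M).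

Lemma smooth_at_open V x f : open V -> V x -> smooth V f -> smooth_at x f.
Proof. by move=> oV Vx fV; exists V. Qed.

Lemma tvec_linE (a : C) u v f : (a *: u + v) f = a * u f + v f.
Proof. by []. Qed.

Lemma tvecE : (forall u v f, (u + v) f = u f + v f) *
    (forall u f, (- u) f = - u f) * (forall (a : C) u f, (a *: u) f = a * u f).
Proof. by []. Qed.

Lemma tangent_lin x (a : C) u v :
  tangent x u -> tangent x v -> tangent x (a *: u + v).
Proof.
move=> [u1 u2 u3 u4] [v1 v2 v3 v4]; split.
- by move=> f nf; rewrite tvec_linE u1// v1// mulr0 addr0.
- by move=> f h sf fh; rewrite !tvec_linE (u2 f h)// (v2 f h).
- by move=> b f h sf sh; rewrite !tvec_linE u3// v3//; ring.
- by move=> f h sf sh; rewrite !tvec_linE u4// v4//; ring.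
Qed.

Lemma tangent0 x : tangent x (0 : tvec M).
Proof.
have e0 f : (0 : tvec M) f = 0 by [].
by split=> // *; rewrite !e0 !mulr0 addr0.
Qed.

Lemma tangentZ x (a : C) u : tangent x u -> tangent x (a *: u).
Proof. by move=> tu; rewrite -[_ *: _]addr0; apply: tangent_lin (tangent0 x). Qed.

Lemma tangentD x u v : tangent x u -> tangent x v -> tangent x (u + v).
Proof. by move=> tu tv; rewrite -[u]scale1r; exact: tangent_lin. Qed.

Lemma tangentN x u : tangent x u -> tangent x (- u).
Proof. by rewrite -scaleN1r; exact: tangentZ. Qed.

Lemma tangentB x u v : tangent x u -> tangent x v -> tangent x (u - v).
Proof. by move=> tu tv; apply: tangentD => //; exact: tangentN. Qed.

Lemma tangent_eq V x v f h : open V -> V x -> tangent x v -> smooth V f ->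
  (forall y, V y -> f y = h y) -> v f = v h.
Proof.
move=> oV Vx [_ vl _ _] sf fh; apply: vl; first exact: smooth_at_open sf.
by apply: (filterS fh); exact: open_nbhs_nbhs.
Qed.

Lemma tangent_addf x v f h : tangent x v -> smooth_at x f -> smooth_at x h ->
  v (fun y => f y + h y) = v f + v h.
Proof.
move=> [_ _ vl _] sf sh; rewrite -[v f]mul1r -vl//; congr (v _).
by apply/funext => y; rewrite mul1r.
Qed.

Lemma tangent_subf x v f h : tangent x v -> smooth_at x f -> smooth_at x h ->
  v (fun y => f y - h y) = v f - v h.
Proof.
move=> [_ _ vl _] sf sh; rewrite addrC -mulN1r -vl//; congr (v _).
by apply/funext => y; rewrite mulN1r addrC.
Qed.

(** The Leibniz rule on [1 * 1] gives [v 1 = v 1 + v 1], hence [v 1 = 0]; linearity then handles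
    every constant. *)
Lemma tangent_cst x v (a : C) : tangent x v -> v (fun=> a) = 0.
Proof.
move=> [_ _ vl vm].
have sc (b : C) : smooth_at x (fun=> b) by
  exists setT; split => //; [exact: openT|exact: smooth_cst].
have dbl (b : C) : b = b + b -> b = 0.
  by move=> /eqP; rewrite -subr_eq subrr => /eqP <-.
have v1 : v (fun=> 1) = 0.
  by apply: dbl; have := vm _ _ (sc 1) (sc 1); rewrite mulr1 mul1r.
have v0 : v (fun=> 0) = 0.
  by apply: dbl; have := vl 1 _ _ (sc 0) (sc 0); rewrite mulr0 add0r mul1r.
have := vl a _ _ (sc 1) (sc 0).
by rewrite v1 v0 mulr0 addr0 mulr1 addr0.
Qed.

Lemma vector_field_sub U V X : open V -> V `<=` U ->
  vector_field U X -> vector_field V X.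
Proof.
move=> oV VU [tX sX]; split=> [x /VU/tX//|W f oW fW].
by apply: smooth_sub (sX W f oW fW) => x [/VU].
Qed.

Lemma vector_field_eq U X Y : open U -> (forall x, U x -> X x = Y x) ->
  vector_field U X -> vector_field U Y.
Proof.
move=> oU XY [tX sX]; split=> [x Ux|W f oW fW]; first by rewrite -XY//; exact: tX.
apply: smooth_eq (sX W f oW fW); first exact: openI.
by move=> x [Ux _]; rewrite /act XY.
Qed.

Lemma vector_field_act U X f :
  open U -> vector_field U X -> smooth U f -> smooth U (act X f).
Proof. by move=> oU [_ sX] /(sX _ _ oU); rewrite setIid. Qed.

Lemma vector_field_lin U X Y f : open U -> smooth U f ->
  vector_field U X -> vector_field U Y ->
  vector_field U (fun x => f x *: X x + Y x).
Proof.
move=> oU fU [tX sX] [tY sY]; split=> [x Ux|W h oW hW].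
  exact: tangent_lin (tX _ Ux) (tY _ Ux).
have oUW := openI oU oW.
have fUW : smooth (U `&` W) f by apply: smooth_sub fU => x [].
exact: smoothD oUW (smoothM oUW fUW (sX W h oW hW)) (sY W h oW hW).
Qed.

Lemma vector_fieldB U X Y : open U ->
  vector_field U X -> vector_field U Y -> vector_field U (fun x => X x - Y x).
Proof.
move=> oU vX vY.
apply: vector_field_eq (vector_field_lin oU (smooth_cst U (-1)) vY vX) => // x _.
by rewrite scaleN1r addrC.
Qed.

Lemma section_tangent U X : vector_field U X -> section tangent U X.
Proof. by move=> vX; split=> //; exact: vX.1. Qed.

Lemma span2_lin (a : C) u v w w' :
  span2 u v w -> span2 u v w' -> span2 u v (a *: w + w').
Proof.
move=> [a1 [b1 ->]] [a2 [b2 ->]]; exists (a * a1 + a2), (a * b1 + b2).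
by apply/funext => f; rewrite !tvecE; ring.
Qed.

(** Gives linearity of [N] at every point of the manifold, as [curvatureC] requires, whereas an
    adapted frame gives it only on its own domain. *)
Lemma rank2_subbundle_lin (N : M -> set (tvec M)) x (a : C) u v :
  rank2_subbundle N -> N x u -> N x v -> N x (a *: u + v).
Proof.
by move=> /(_ x)[U [X [Y [_ Ux _ _ /(_ x Ux)[-> _]]]]]; exact: span2_lin.
Qed.

Lemma section_sub (D : M -> set (tvec M)) U V X : open V -> V `<=` U ->
  section D U X -> section D V X.
Proof.
by move=> oV VU [vX DX]; split; [exact: vector_field_sub vX|move=> x /VU/DX].
Qed.

Lemma bracketE x X Y f : smooth_at x f ->
  bracket X Y x f = X x (act Y f) - Y x (act X f).
Proof. by move=> sf; rewrite /bracket asboolT. Qed.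

Lemma bracketC x X Y : bracket X Y x = - bracket Y X x.
Proof.
apply/funext => f; rewrite fctE /= /bracket.
by case: asboolP => _; rewrite ?opprB ?oppr0.
Qed.

(** The bracket acts as a commutator at every point of [U], not only at [x], so by locality the
    identity may be differentiated along [X]. *)
Lemma bracket_act U X Y Z f x : open U -> U x ->
  vector_field U X -> vector_field U Y -> vector_field U Z -> smooth U f ->
  X x (act (bracket Y Z) f) = X x (act Y (act Z f)) - X x (act Z (act Y f)).
Proof.
move=> oU Ux vX vY vZ sf; have tX := vX.1 _ Ux.
have sYZ := vector_field_act oU vY (vector_field_act oU vZ sf).
have sZY := vector_field_act oU vZ (vector_field_act oU vY sf).
rewrite -(tangent_subf tX); [|exact: smooth_at_open sYZ|exact: smooth_at_open sZY].
apply/esym/(tangent_eq oU Ux tX); first exact: smoothB.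
by move=> y Uy; rewrite /act bracketE//; exact: smooth_at_open sf.
Qed.

(** On a smooth germ this is the Jacobi identity for commutators of operators; on any other germ
    each bracket takes the default value 0. *)
Lemma jacobi U X Y Z x : open U -> U x ->
  vector_field U X -> vector_field U Y -> vector_field U Z ->
  bracket X (bracket Y Z) x + bracket Y (bracket Z X) x
    + bracket Z (bracket X Y) x = 0.
Proof.
move=> oU Ux vX vY vZ; apply/funext => f; rewrite !fctE /=.
have [[W [oW Wx sf]]|nf] := pselect (smooth_at x f); last first.
  by rewrite /bracket !asboolF// !addr0.
(* The smooth germ lives only on [W], so everything is restricted to the intersection, where all
   iterated derivatives are smooth. *)
have oUW := openI oU oW.
have sub := vector_field_sub oUW (@subIsetl _ U W).
have {vX} vX := sub _ vX; have {vY} vY := sub _ vY; have {vZ} vZ := sub _ vZ.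
have {}sf : smooth (U `&` W) f by apply: smooth_sub sf => y [].
have UWx : (U `&` W) x by [].
have sa h : smooth (U `&` W) h -> smooth_at x h by exact: smooth_at_open.
have sX := sa _ (vector_field_act oUW vX sf).
have sY := sa _ (vector_field_act oUW vY sf).
have sZ := sa _ (vector_field_act oUW vZ sf).
rewrite !(bracketE _ _ (sa _ sf)) !(bracket_act oUW)// !bracketE//.
by ring.
Qed.

End VectorFields.

(** * Sign rules for general connections along a distribution *)

Section Connections.
Context {R : realType} {M : manifold4 R}.
Local Notation C := R[i].
Variables (U : set M) (D E : M -> set (tvec M)).
Variables (nab : vfield M -> vfield M -> vfield M).
Hypothesis cnab : connection U D E nab.
Hypothesis D_lin : forall x (a : C) u v, D x u -> D x v -> D x (a *: u + v).

(** The zero field is written both as [-1 *: X + X] and as [1 *: X + X']; linearity of the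
    connection in its direction, applied to the two forms, gives the sign. *)
Lemma connection_opp (V : set M) X X' Y x : open V -> V `<=` U -> V x ->
  section D V X -> section E V Y ->
  (forall y, V y -> X' y = - X y) -> nab X' Y x = - nab X Y x.
Proof.
move=> oV VU Vx sX sY X'N; have [_ loc lin _] := cnab oV VU.
have s1 := smooth_cst V (-1 : R[i]); have [vX DX] := sX.
have z0 : section D V (fun y => -1 *: X y + X y).
  by split; [exact: vector_field_lin|move=> y Vy; apply: D_lin; exact: DX].
have sX' : section D V X'.
  split.
    apply: vector_field_eq (vector_field_lin oV s1 vX z0.1) => // y Vy.
    by rewrite X'N// !scaleN1r addNr addr0.
  move=> y Vy; rewrite X'N//.
  (* [- X y] is obtained as [-1 *: X y] plus the zero vector, itself already known to lie in
     [D y]. *)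
  have := D_lin (-1) (DX _ Vy) (z0.2 _ Vy).
  by rewrite !scaleN1r addNr addr0.
have e1 := lin _ _ _ _ s1 sX sX sY x Vx.
have e2 := lin _ _ _ _ (smooth_cst V (1 : R[i])) sX sX' sY x Vx.
have e3 : nab (fun y => -1 *: X y + X y) Y x
        = nab (fun y => 1 *: X y + X' y) Y x.
  apply: (loc _ _ _ _ z0 sY) => // y Vy.
  by rewrite X'N// scaleN1r scale1r addNr addrN.
move: e2; rewrite -e3 e1 scaleN1r addNr scale1r => /esym/eqP.
by rewrite addrC addr_eq0 => /eqP.
Qed.

Lemma curvatureC (V : set M) X Y Z x : open V -> V `<=` U -> V x ->
  section D V (bracket X Y) -> section E V Z ->
  curvature nab X Y Z x = - curvature nab Y X Z x.
Proof.
move=> oV VU Vx sB sZ; rewrite /curvature.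
rewrite (@connection_opp V (bracket X Y) (bracket Y X))//; last first.
  by move=> y _; exact: bracketC.
by rewrite opprK opprD opprB.
Qed.

End Connections.

(** * Bilinear algebra of the metric on tangent vectors *)

Section Metric.
Context {R : realType} {M : manifold4 R} (g : bilinear_form M) (hg : metric g).
Local Notation C := R[i].
Implicit Types (x : M) (u v w : tvec M).

Lemma metricC x u v : tangent x u -> tangent x v -> g x u v = g x v u.
Proof. by have [_ + _ _] := hg; exact. Qed.

Lemma metric_linl x (a : C) u v w : tangent x u -> tangent x v -> tangent x w ->
  g x (a *: u + v) w = a * g x u w + g x v w.
Proof. by have [+ _ _ _] := hg; exact. Qed.

Lemma metricDl x u v w : tangent x u -> tangent x v -> tangent x w ->
  g x (u + v) w = g x u w + g x v w.
Proof. by move=> tu tv tw; rewrite -[u]scale1r metric_linl// scale1r mul1r. Qed.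

Lemma metric0l x w : tangent x w -> g x 0 w = 0.
Proof.
move=> tw; have t0 := tangent0 x; have := metricDl t0 t0 tw.
by rewrite addr0 => /eqP; rewrite -subr_eq subrr => /eqP <-.
Qed.

Lemma metricZl x (a : C) u w : tangent x u -> tangent x w ->
  g x (a *: u) w = a * g x u w.
Proof.
move=> tu tw; rewrite -[_ *: _]addr0 metric_linl//; last exact: tangent0.
by rewrite metric0l// addr0.
Qed.

Lemma metricNl x u w : tangent x u -> tangent x w -> g x (- u) w = - g x u w.
Proof. by move=> tu tw; rewrite -scaleN1r metricZl// mulN1r. Qed.

Lemma metricBl x u v w : tangent x u -> tangent x v -> tangent x w ->
  g x (u - v) w = g x u w - g x v w.
Proof.
by move=> tu tv tw; rewrite metricDl ?metricNl//; exact: tangentN.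
Qed.

Lemma metricBr x u v w : tangent x u -> tangent x v -> tangent x w ->
  g x w (u - v) = g x w u - g x w v.
Proof.
move=> tu tv tw; rewrite metricC//; last exact: tangentB.
by rewrite metricBl// !(metricC tw).
Qed.

Lemma metric_linr x (a : C) u v w : tangent x u -> tangent x v -> tangent x w ->
  g x w (a *: u + v) = a * g x w u + g x w v.
Proof.
move=> tu tv tw; rewrite metricC//; last exact: tangent_lin.
by rewrite metric_linl// !(metricC tw).
Qed.

Lemma smooth_ip (V : set M) X Y : open V ->
  vector_field V X -> vector_field V Y -> smooth V (ip g X Y).
Proof. by have [_ _ _ +] := hg; exact. Qed.

End Metric.

(** * Symmetries of the Levi-Civita curvature *)

Section LeviCivita.
Context {R : realType} {M : manifold4 R} (g : bilinear_form M) (hg : metric g).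
Variable nabla : vfield M -> vfield M -> vfield M.
Hypothesis lc : levi_civita g nabla.
Variables (V : set M) (oV : open V).
Local Notation C := R[i].
Implicit Types (x : M) (X Y Z W : vfield M).

Let VT : V `<=` setT. Proof. by []. Qed.

Lemma vector_field_nabla X Y : vector_field V X -> vector_field V Y ->
  vector_field V (nabla X Y).
Proof.
have [cn _ _] := lc; have [cs _ _ _] := cn V oV VT.
by move=> /section_tangent sX /section_tangent sY; have [] := cs _ _ sX sY.
Qed.

Lemma bracket_nabla X Y x : vector_field V X -> vector_field V Y -> V x ->
  bracket X Y x = nabla X Y x - nabla Y X x.
Proof.
have [_ tf _] := lc => vX vY Vx; apply/esym/eqP; rewrite -subr_eq0; apply/eqP.
by apply: tf Vx => //; exact: section_tangent.
Qed.

Lemma vector_field_bracket X Y : vector_field V X -> vector_field V Y ->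
  vector_field V (bracket X Y).
Proof.
move=> vX vY; have vXY := vector_field_nabla vX vY.
have vYX := vector_field_nabla vY vX.
apply: vector_field_eq (vector_fieldB oV vXY vYX) => // x Vx.
by rewrite bracket_nabla.
Qed.

Lemma act_ip X Y Z x :
  vector_field V X -> vector_field V Y -> vector_field V Z -> V x ->
  X x (ip g Y Z) = ip g (nabla X Y) Z x + ip g Y (nabla X Z) x.
Proof.
have [_ _ dg] := lc => vX vY vZ Vx; have /eqP := dg V X Y Z oV vX vY vZ x Vx.
by rewrite /deriv_metric -addrA -opprD subr_eq0 => /eqP.
Qed.

(** A constant product has zero derivative, so metric compatibility leaves two terms that cancel.
    This applies to the products of null frame vectors. *)
Lemma ip_nabla_cst X Y Z (c : C) x :
  vector_field V X -> vector_field V Y -> vector_field V Z ->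
  (forall y, V y -> g y (Y y) (Z y) = c) -> V x ->
  g x (nabla X Y x) (Z x) = - g x (Y x) (nabla X Z x).
Proof.
move=> vX vY vZ YZ Vx; have tX := vX.1 _ Vx.
have := act_ip vX vY vZ Vx.
rewrite (tangent_eq oV Vx tX (smooth_ip hg oV vY vZ) YZ) (tangent_cst _ tX).
by move=> /esym/eqP; rewrite addr_eq0 => /eqP.
Qed.

Lemma ip_nabla_null X Y x : vector_field V X -> vector_field V Y ->
  (forall y, V y -> g y (Y y) (Y y) = 0) -> V x ->
  g x (nabla X Y x) (Y x) = 0.
Proof.
move=> vX vY YY Vx; apply: self_opp.
have t := (vector_field_nabla vX vY).1 _ Vx; have tY := vY.1 _ Vx.
by rewrite {1}(ip_nabla_cst vX vY vY YY Vx) (metricC hg tY t).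
Qed.

Lemma nablaB X Y Z x :
  vector_field V X -> vector_field V Y -> vector_field V Z -> V x ->
  nabla X (fun y => Y y - Z y) x = nabla X Y x - nabla X Z x.
Proof.
have [cn _ _] := lc => vX vY vZ Vx; have [_ loc _ lei] := cn V oV VT.
have s1 := smooth_cst V (-1 : C).
transitivity (nabla X (fun y => -1 *: Z y + Y y) x).
  apply: loc Vx => //; try exact: section_tangent.
    by apply: section_tangent; exact: vector_fieldB.
  by move=> y _; rewrite scaleN1r addrC.
rewrite (lei (fun=> -1))//; try exact: section_tangent.
by rewrite /act (tangent_cst _ (vX.1 _ Vx)) scale0r add0r scaleN1r addrC.
Qed.

Lemma nabla_eq X Y Y' x : vector_field V X -> vector_field V Y -> V x ->
  (forall y, V y -> Y y = Y' y) -> nabla X Y x = nabla X Y' x.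
Proof.
have [cn _ _] := lc => vX vY Vx YY; have [_ loc _ _] := cn V oV VT.
by apply: loc Vx => //; exact: section_tangent.
Qed.

Lemma tangent_curvature X Y Z x :
  vector_field V X -> vector_field V Y -> vector_field V Z -> V x ->
  tangent x (curvature nabla X Y Z x).
Proof.
move=> vX vY vZ Vx; rewrite /curvature.
have vN X' Y' : vector_field V X' -> vector_field V Y' ->
  tangent x (nabla X' Y' x).
  by move=> vX' vY'; have [+ _] := vector_field_nabla vX' vY'; exact.
apply: tangentB; first apply: tangentB; apply: vN => //;
  by [exact: vector_field_nabla|exact: vector_field_bracket].
Qed.

Lemma lc_curvatureC X Y Z x :
  vector_field V X -> vector_field V Y -> vector_field V Z -> V x ->
  curvature nabla X Y Z x = - curvature nabla Y X Z x.
Proof.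
have [cn _ _] := lc => vX vY vZ Vx.
apply: (curvatureC cn _ oV) => //; last exact: section_tangent.
  exact: tangent_lin.
by apply: section_tangent; exact: vector_field_bracket.
Qed.

(** Vanishing torsion turns each double bracket into covariant derivatives; the Jacobi identity then
    regroups into the cyclic sum of curvatures. *)
Lemma bianchi X Y Z x :
  vector_field V X -> vector_field V Y -> vector_field V Z -> V x ->
  curvature nabla X Y Z x + curvature nabla Y Z X x + curvature nabla Z X Y x
    = 0.
Proof.
move=> vX vY vZ Vx.
have br X' Y' Z' : vector_field V X' -> vector_field V Y' ->
  vector_field V Z' -> bracket X' (bracket Y' Z') x =
    nabla X' (nabla Y' Z') x - nabla X' (nabla Z' Y') x
    - nabla (bracket Y' Z') X' x.
  move=> vX' vY' vZ'; have vB := vector_field_bracket vY' vZ'.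
  have v1 := vector_field_nabla vY' vZ'; have v2 := vector_field_nabla vZ' vY'.
  rewrite bracket_nabla// -nablaB//; congr (_ - _).
  by apply: nabla_eq => // y Vy; rewrite bracket_nabla.
have := jacobi oV Vx vX vY vZ; rewrite !br// => <-; rewrite /curvature.
by apply/funext => f; rewrite !fctE /=; ring.
Qed.

(** The commutator of [X] and [Y] is applied to the function [g(Z, W)] and expanded by metric
    compatibility; the mixed first-order products cancel, leaving the two curvature terms. *)
Lemma riem_skew X Y Z W x : vector_field V X -> vector_field V Y ->
  vector_field V Z -> vector_field V W -> V x ->
  riem g nabla Z W X Y x = - riem g nabla W Z X Y x.
Proof.
move=> vX vY vZ vW Vx.
have vN := vector_field_nabla; have vB := vector_field_bracket vX vY.
have sip := smooth_ip hg oV.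
have actact X' Y' : vector_field V X' -> vector_field V Y' ->
  X' x (act Y' (ip g Z W)) =
    ip g (nabla X' (nabla Y' Z)) W x + ip g (nabla Y' Z) (nabla X' W) x
    + (ip g (nabla X' Z) (nabla Y' W) x + ip g Z (nabla X' (nabla Y' W)) x).
  move=> vX' vY'; have tX := vX'.1 _ Vx.
  have s1 := sip _ _ (vN _ _ vY' vZ) vW; have s2 := sip _ _ vZ (vN _ _ vY' vW).
  rewrite -(act_ip vX' (vN _ _ vY' vZ) vW Vx) -(act_ip vX' vZ (vN _ _ vY' vW) Vx).
  rewrite -(tangent_addf tX);
    [|exact: smooth_at_open oV Vx s1|exact: smooth_at_open oV Vx s2].
  apply/esym/(tangent_eq oV Vx tX); first exact: smoothD.
  by move=> y Vy; rewrite [RHS]act_ip.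
have := act_ip vB vZ vW Vx.
rewrite (bracketE _ _ (smooth_at_open oV Vx (sip _ _ vZ vW))) !actact//.
have tn X' Y' : vector_field V X' -> vector_field V Y' -> tangent x (nabla X' Y' x).
  by move=> vX' vY'; exact: (vN _ _ vX' vY').1.
have tZ := vZ.1 _ Vx; have tW := vW.1 _ Vx.
have t1 := tn _ _ vX (vN _ _ vY vZ); have t2 := tn _ _ vY (vN _ _ vX vZ).
have t3 := tn _ _ vX (vN _ _ vY vW); have t4 := tn _ _ vY (vN _ _ vX vW).
have t5 := tn _ _ vB vZ; have t6 := tn _ _ vB vW.
rewrite /riem /ip /curvature !(metricBr hg)//; try exact: tangentB.
rewrite !(metricC hg tW)//.
by move=> /transfer_eq; apply; ring.
Qed.

Lemma riemC X Y Z W x : vector_field V X -> vector_field V Y ->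
  vector_field V Z -> vector_field V W -> V x ->
  riem g nabla X Y Z W x = - riem g nabla X Y W Z x.
Proof.
move=> vX vY vZ vW Vx; rewrite /riem /ip lc_curvatureC//.
have t := tangent_curvature vW vZ vY Vx; have tX := vX.1 _ Vx.
by rewrite (metricC hg tX (tangentN t)) (metricNl hg t tX) (metricC hg t tX).
Qed.

Lemma riem_bianchi X Y Z W x : vector_field V X -> vector_field V Y ->
  vector_field V Z -> vector_field V W -> V x ->
  riem g nabla X Y Z W x + riem g nabla X Z W Y x + riem g nabla X W Y Z x = 0.
Proof.
move=> vX vY vZ vW Vx; rewrite /riem /ip; have tX := vX.1 _ Vx.
have t1 := tangent_curvature vZ vW vY Vx.
have t2 := tangent_curvature vW vY vZ Vx.
have t3 := tangent_curvature vY vZ vW Vx.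
rewrite !(metricC hg tX)// -!(metricDl hg)//; last exact: tangentD.
by rewrite bianchi// (metric0l hg).
Qed.

(** The classical argument: an alternating combination of four Bianchi identities, one for each
    vector in the lowered slot, reduces by skew-symmetry to twice the difference of the two
    sides. *)
Lemma riem_pair X Y Z W x : vector_field V X -> vector_field V Y ->
  vector_field V Z -> vector_field V W -> V x ->
  riem g nabla X Y Z W x = riem g nabla Z W X Y x.
Proof.
move=> vX vY vZ vW Vx.
have b1 := riem_bianchi vX vY vZ vW Vx; have b2 := riem_bianchi vY vZ vW vX Vx.
have b3 := riem_bianchi vZ vW vX vY Vx; have b4 := riem_bianchi vW vX vY vZ Vx.
rewrite (riemC vX vZ vW vY Vx) in b1.
rewrite (riemC vY vZ vW vX Vx) (riem_skew vZ vW vY vX Vx) in b2.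
have e3 : riem g nabla Z Y W X x = riem g nabla Y Z X W x.
  by rewrite (riem_skew vW vX vZ vY Vx) (riemC vY vZ vW vX Vx) opprK.
have e4 : riem g nabla W Y Z X x = riem g nabla Y W X Z x.
  by rewrite (riem_skew vZ vX vW vY Vx) (riemC vY vW vZ vX Vx) opprK.
rewrite (riem_skew vY vW vZ vX Vx) e3 in b3.
rewrite (riem_skew vY vZ vW vX Vx) e4 (riem_skew vX vY vW vZ Vx) in b4.
move: b1 b2 b3 b4.
set a1 := riem _ _ X Y Z W x; set a2 := riem _ _ Z W X Y x.
set c1 := riem _ _ X Z Y W x; set c2 := riem _ _ Y W X Z x.
set d1 := riem _ _ X W Y Z x; set d2 := riem _ _ Y Z X W x => b1 b2 b3 b4.
have : 2 * (a1 - a2) = 0.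
  transitivity (a1 - c1 + d1 - (- d2 + c2 - a1) - (a2 - c1 + d2)
    + (- d1 + c2 - a2)); first by ring.
  by rewrite b1 b2 b3 b4 !subr0 addr0.
by move/eqP; rewrite mulf_eq0 pnatr_eq0 /= subr_eq0 => /eqP.
Qed.

End LeviCivita.

(** * Null frames *)

Section NullFrame.
Context {R : realType} {M : manifold4 R}.
Variables (g : bilinear_form M) (hg : metric g).
Local Notation C := R[i].
Implicit Types (x : M) (U V : set M) (u v w : tvec M).
Implicit Types (X Y Z m p n k : vfield M) (N : M -> set (tvec M)).

(* Unlike [adapted_null_frame], this spells the frame out vector by vector, so
   that the exchange of [null_frame_swap] needs no permutation of ['I_4]. *)
Record null_frame N V m p n k : Prop := NullFrame {
  nf_m : vector_field V m;
  nf_p : vector_field V p;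
  nf_n : vector_field V n;
  nf_k : vector_field V k;
  nf_mp : forall x, V x -> g x (m x) (p x) = 1;
  nf_nk : forall x, V x -> g x (n x) (k x) = 1;
  nf_mm : forall x, V x -> g x (m x) (m x) = 0;
  nf_pp : forall x, V x -> g x (p x) (p x) = 0;
  nf_nn : forall x, V x -> g x (n x) (n x) = 0;
  nf_kk : forall x, V x -> g x (k x) (k x) = 0;
  nf_mn : forall x, V x -> g x (m x) (n x) = 0;
  nf_mk : forall x, V x -> g x (m x) (k x) = 0;
  nf_pn : forall x, V x -> g x (p x) (n x) = 0;
  nf_pk : forall x, V x -> g x (p x) (k x) = 0;
  nf_N : forall x, V x -> N x = span2 (m x) (k x);
  nf_span : forall x v, V x -> tangent x v -> exists a b c d : C,
    v = a *: m x + (b *: p x + (c *: n x + d *: k x)) }.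

Lemma adapted_null_frameP N U V m p n k : open V -> V `<=` U ->
  adapted_null_frame g N U m p n k -> null_frame N V m p n k.
Proof.
move=> oV VU [[vf sp] pr].
have v (i : 'I_4) : vector_field V (frame4 m p n k i) by exact: vector_field_sub (vf i).
split; try (by move=> x /VU /pr [[? ?] [? ? ? ?] [? ? ? ?] ?]).
- exact: (v 0).
- exact: (v 1).
- exact: (v 2).
- exact: (v 3).
move=> x u /VU Ux tu; have [/(_ u tu) [c ->] _] := sp x Ux.
exists (c ord0), (c (lift ord0 ord0)), (c (lift ord0 (lift ord0 ord0))),
  (c (lift ord0 (lift ord0 (lift ord0 ord0)))).
by rewrite !big_ord_recl big_ord0 addr0.
Qed.

(** This symmetry reduces the action of the curvature on [k] to its action on [m]. *)
Lemma null_frame_swap N V m p n k : null_frame N V m p n k -> null_frame N V k n p m.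
Proof.
move=> F; have [vm vp vn vk] := And4 (nf_m F) (nf_p F) (nf_n F) (nf_k F).
have tm x : V x -> tangent x (m x) := vm.1 x.
have tp x : V x -> tangent x (p x) := vp.1 x.
have tn x : V x -> tangent x (n x) := vn.1 x.
have tk x : V x -> tangent x (k x) := vk.1 x.
split => // x.
- by move=> Vx; rewrite (metricC hg (tk x Vx) (tn x Vx)) (nf_nk F).
- by move=> Vx; rewrite (metricC hg (tp x Vx) (tm x Vx)) (nf_mp F).
- exact: nf_kk F x.
- exact: nf_nn F x.
- exact: nf_pp F x.
- exact: nf_mm F x.
- by move=> Vx; rewrite (metricC hg (tk x Vx) (tp x Vx)) (nf_pk F).
- by move=> Vx; rewrite (metricC hg (tk x Vx) (tm x Vx)) (nf_mk F).
- by move=> Vx; rewrite (metricC hg (tn x Vx) (tp x Vx)) (nf_pn F).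
- by move=> Vx; rewrite (metricC hg (tn x Vx) (tm x Vx)) (nf_mn F).
- move=> Vx; rewrite (nf_N F Vx); apply/seteqP; split=> v [a [b ->]]; exists b, a;
    by rewrite addrC.
- move=> v Vx tv; have [a [b [c [d ->]]]] := nf_span F Vx tv.
  exists d, c, b, a; apply/funext => f; rewrite !tvecE; ring.
Qed.

(** The dual frame of [(m, p, n, k)] is [(p, m, k, n)]: pairing an arbitrary expansion with each of
    these identifies its coefficients. *)
Lemma null_frame_expand N V m p n k x u : null_frame N V m p n k -> V x ->
  tangent x u -> u = g x u (p x) *: m x
    + (g x u (m x) *: p x + (g x u (k x) *: n x + g x u (n x) *: k x)).
Proof.
move=> F Vx tu; have [a [b [c [d e]]]] := nf_span F Vx tu.
have tm := (nf_m F).1 _ Vx; have tp := (nf_p F).1 _ Vx.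
have tn := (nf_n F).1 _ Vx; have tk := (nf_k F).1 _ Vx.
have E w : tangent x w -> g x u w = a * g x (m x) w
    + (b * g x (p x) w + (c * g x (n x) w + d * g x (k x) w)).
  move=> tw; rewrite e !(metric_linl hg) ?(metricZl hg)//.
  - exact: tangentZ.
  - by apply: tangent_lin => //; exact: tangentZ.
  - by do 2!apply: tangent_lin => //; exact: tangentZ.
rewrite !E// (metricC hg tp tm) (metricC hg tk tn) (metricC hg tn tm)
  (metricC hg tn tp) (metricC hg tk tm) (metricC hg tk tp).
rewrite (nf_mp F)// (nf_nk F)// (nf_mm F)// (nf_pp F)// (nf_nn F)// (nf_kk F)//.
rewrite (nf_mn F)// (nf_mk F)// (nf_pn F)// (nf_pk F)// {1}e.
by rewrite !mulr1 !mulr0 !addr0 !add0r.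
Qed.

(** Nondegeneracy tested against fields rather than vectors, as the comparison of connections is an
    identity between fields; the four frame fields suffice. *)
Lemma null_frame_nondeg N V m p n k x u v : null_frame N V m p n k -> V x ->
  tangent x u -> tangent x v ->
  (forall X, vector_field V X -> g x u (X x) = g x v (X x)) -> u = v.
Proof.
move=> F Vx tu tv uv; rewrite (null_frame_expand F Vx tu) !uv.
- by rewrite -(null_frame_expand F Vx tv).
- exact: nf_n F.
- exact: nf_k F.
- exact: nf_m F.
- exact: nf_p F.
Qed.

(** * The Weyl component [C_1434] in a null frame *)

Section Weyl.
Variables (N : M -> set (tvec M)) (V : set M) (m p n k : vfield M).
Variable nabla : vfield M -> vfield M -> vfield M.
Hypothesis lc : levi_civita g nabla.
Hypothesis oV : open V.
Hypothesis F : null_frame N V m p n k.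

(** The Gram matrix is the permutation matrix exchanging 1 with 2 and 3 with 4, hence its own
    inverse. *)
Lemma ginv_null_frame x : V x ->
  ginv g (frame4 m p n k) x
  = \matrix_(a, b) ip g (frame4 m p n k a) (frame4 m p n k b) x.
Proof.
move=> Vx; rewrite /ginv; set G := \matrix_(a, b) _.
have GG : G *m G = 1%:M.
  have tm := (nf_m F).1 _ Vx; have tp := (nf_p F).1 _ Vx.
  have tn := (nf_n F).1 _ Vx; have tk := (nf_k F).1 _ Vx.
  apply/matrixP => i j; rewrite !mxE !big_ord_recl big_ord0 !mxE /ip.
  have f0 : frame4 m p n k ord0 = m by [].
  have f1 : frame4 m p n k (lift ord0 ord0) = p by [].
  have f2 : frame4 m p n k (lift ord0 (lift ord0 ord0)) = n by [].
  have f3 : frame4 m p n k (lift ord0 (lift ord0 (lift ord0 ord0))) = k by [].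
  rewrite f0 f1 f2 f3 /frame4.
  have pm := metricC hg tp tm; have km := metricC hg tk tm.
  have nm := metricC hg tn tm; have kp := metricC hg tk tp.
  have np := metricC hg tn tp; have kn := metricC hg tk tn.
  by case: i => [[|[|[|[|i]]]] lti] //; case: j => [[|[|[|[|j]]]] ltj] //;
    rewrite /tnth /= ?pm ?km ?nm ?kp ?np ?kn
      ?(nf_mp F)// ?(nf_nk F)// ?(nf_mm F)// ?(nf_pp F)// ?(nf_nn F)//
      ?(nf_kk F)// ?(nf_mn F)// ?(nf_mk F)// ?(nf_pn F)// ?(nf_pk F)//
      ?mulr0 ?mulr1 ?addr0 ?add0r.
have [uG _] := mulmx1_unit GG.
by rewrite -[LHS]mulmx1 -GG mulmxA mulVmx// mul1mx.
Qed.

(** Among the metric factors in [C_1434] only [g_43 = 1] survives, leaving [R_1434 + P_41]. The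
    scalar curvature drops out of [P_41] because [g_41 = 0]. *)
Lemma weyl_riem_null_frame x : V x ->
  2 * weyl g nabla (frame4 m p n k) m k n k x
  = riem g nabla m k n k x + riem g nabla p m m k x.
Proof.
move=> Vx; have [vm vp vn vk] := And4 (nf_m F) (nf_p F) (nf_n F) (nf_k F).
have tm := vm.1 _ Vx; have tp := vp.1 _ Vx.
have tn := vn.1 _ Vx; have tk := vk.1 _ Vx.
have f0 : frame4 m p n k ord0 = m by [].
have f1 : frame4 m p n k (lift ord0 ord0) = p by [].
have f2 : frame4 m p n k (lift ord0 (lift ord0 ord0)) = n by [].
have f3 : frame4 m p n k (lift ord0 (lift ord0 (lift ord0 ord0))) = k by [].
have pm := metricC hg tp tm; have km := metricC hg tk tm.
have nm := metricC hg tn tm; have kp := metricC hg tk tp.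
have np := metricC hg tn tp; have kn := metricC hg tk tn.
have rk : ricci g nabla (frame4 m p n k) k m x
          = riem g nabla p k m m x + riem g nabla m k p m x
            + (riem g nabla k k n m x + riem g nabla n k k m x).
  rewrite /ricci ginv_null_frame// !big_ord_recl !big_ord0 !mxE f0 f1 f2 f3 /ip.
  rewrite ?pm ?km ?nm ?kp ?np ?kn
      ?(nf_mp F)// ?(nf_nk F)// ?(nf_mm F)// ?(nf_pp F)// ?(nf_nn F)//
      ?(nf_kk F)// ?(nf_mn F)// ?(nf_mk F)// ?(nf_pn F)// ?(nf_pk F)//.
  by rewrite !mul0r !mul1r !addr0 !add0r addrA.
have z1 : riem g nabla p k m m x = 0.
  exact: self_opp (riemC hg lc oV vp vk vm vm Vx).
have z2 : riem g nabla k k n m x = 0.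
  exact: self_opp (riem_skew hg lc oV vn vm vk vk Vx).
rewrite /weyl /schouten rk z1 z2 /ip kn km.
rewrite (nf_mk F)// (nf_mn F)// (nf_nk F)// (nf_kk F)//.
rewrite (riem_pair hg lc oV vm vk vp vm Vx).
have -> : riem g nabla n k k m x = - riem g nabla m k n k x.
  by rewrite (riem_pair hg lc oV vn vk vk vm Vx) (riem_skew hg lc oV vn vk vk vm Vx).
by field.
Qed.

End Weyl.

End NullFrame.

(** * The characteristic connection *)

Section Characteristic.
Context {R : realType} {M : manifold4 R}.
Local Notation C := R[i].
Implicit Types (x : M) (u v w : tvec M) (X Y Z : vfield M).
Variables (g : bilinear_form M) (hg : metric g).
Variable nabla : vfield M -> vfield M -> vfield M.
Hypothesis lc : levi_civita g nabla.
Variable N : M -> set (tvec M).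
Hypothesis hnull : totally_null g N.
Hypothesis hint : integrable_field N.
Variables (V : set M) (oV : open V).
Variables (B : M -> tvec M -> C) (nablaW : vfield M -> vfield M -> vfield M).
Hypothesis hB : one_form V B.
Hypothesis hW : weyl_connection g V B nablaW.
Hypothesis hpres : preserves V N nablaW.
Variable cnabla : vfield M -> vfield M -> vfield M.
Hypothesis hc : connection setT N N cnabla.
Hypothesis hcW : forall X Y, section N V X -> section N V Y ->
  forall y, V y -> cnabla X Y y = nablaW X Y y.

(** With the factor one half, the terms of the difference between the Weyl and Levi-Civita
    connections have coefficients 1 and -1. *)
Definition half_form (x : M) (v : tvec M) : C := 2^-1 * B x v.
Local Notation b := half_form.

Lemma half_form_lin x (a : C) u v : V x -> tangent x u -> tangent x v ->
  b x (a *: u + v) = a * b x u + b x v.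
Proof. by move=> Vx tu tv; rewrite /b hB.1//; ring. Qed.

Lemma half_formB x u v : V x -> tangent x u -> tangent x v ->
  b x (u - v) = b x u - b x v.
Proof.
by move=> Vx tu tv; rewrite addrC -scaleN1r half_form_lin// mulN1r addrC.
Qed.

Lemma smooth_half_form X : vector_field V X -> smooth V (fun x => b x (X x)).
Proof.
move=> vX; apply: smoothM => //; first exact: smooth_cst.
exact: hB.2.
Qed.

Lemma vector_field_weyl X Y : vector_field V X -> vector_field V Y ->
  vector_field V (nablaW X Y).
Proof.
have [cn _ _] := hW; have [cs _ _ _] := cn V oV (fun _ => id).
by move=> /section_tangent sX /section_tangent sY; have [] := cs _ _ sX sY.
Qed.

(* The classical Koszul argument, applied to [nablaW - nabla]. *)
Lemma weyl_levi_civita X Y Z x :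
  vector_field V X -> vector_field V Y -> vector_field V Z -> V x ->
  g x (nablaW X Y x) (Z x) = g x (nabla X Y x) (Z x)
    + (b x (X x) * g x (Y x) (Z x) + b x (Y x) * g x (X x) (Z x)
       - b x (Z x) * g x (X x) (Y x)).
Proof.
move=> vX vY vZ Vx.
have vL := vector_field_nabla lc oV; have vW := vector_field_weyl.
pose D X Y Z := g x (nablaW X Y x - nabla X Y x) (Z x).
have DE X' Y' Z' : vector_field V X' -> vector_field V Y' ->
  vector_field V Z' ->
  D X' Y' Z' = g x (nablaW X' Y' x) (Z' x) - g x (nabla X' Y' x) (Z' x).
  move=> vX' vY' vZ'; rewrite /D (metricBl hg)//.
  - exact: (vW _ _ vX' vY').1.
  - exact: (vL _ _ vX' vY').1.
  - exact: vZ'.1.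
have Dsym X' Y' Z' : vector_field V X' -> vector_field V Y' ->
  D X' Y' Z' = D Y' X' Z'.
  move=> vX' vY'; rewrite /D; congr (g x _ _).
  have := bracket_nabla lc oV vX' vY' Vx.
  have [_ tf _] := hW.
  have := tf V X' Y' oV (fun _ => id) (section_tangent vX') (section_tangent vY') x Vx.
  rewrite /torsion => /eqP; rewrite subr_eq0 => /eqP e1 e2.
  move: e1; rewrite e2 => /transfer_eq; apply; apply/funext => f.
  by rewrite !tvecE; ring.
have Dmet X' Y' Z' : vector_field V X' -> vector_field V Y' ->
  vector_field V Z' ->
  D X' Y' Z' + D X' Z' Y' = 2 * b x (X' x) * g x (Y' x) (Z' x).
  move=> vX' vY' vZ'; have tY := vY'.1 _ Vx; have tZ := vZ'.1 _ Vx.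
  have [_ _ dg] := hW.
  have := dg V X' Y' Z' oV (fun _ => id) vX' vY' vZ' x Vx.
  rewrite /deriv_metric /act (act_ip lc oV vX' vY' vZ' Vx) !DE//.
  have t1 := (vL _ _ vX' vZ').1 _ Vx; have t2 := (vW _ _ vX' vZ').1 _ Vx.
  rewrite /ip (metricC hg tY t1) (metricC hg tY t2) /b.
  have -> : 2 * (2^-1 * B x (X' x)) = B x (X' x).
    by rewrite mulrA mulfV ?mul1r// pnatr_eq0.
  by move=> /esym/transfer_eq; apply; ring.
have e : 2 * D X Y Z = 2 * (b x (X x) * g x (Y x) (Z x)
     + b x (Y x) * g x (X x) (Z x) - b x (Z x) * g x (X x) (Y x)).
  have e1 := Dmet X Y Z vX vY vZ; have e2 := Dmet Y X Z vY vX vZ.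
  have e3 := Dmet Z X Y vZ vX vY.
  rewrite (Dsym Y X)// in e2; rewrite (Dsym Z X)// (Dsym Z Y)// in e3.
  transitivity ((D X Y Z + D X Z Y) + (D X Y Z + D Y Z X) - (D X Z Y + D Y Z X)).
    by ring.
  by rewrite e1 e2 e3; ring.
have n2 : (2 : C) != 0 by rewrite pnatr_eq0.
by have /eqP := mulfI n2 e; rewrite DE// subr_eq addrC => /eqP.
Qed.

Variables m p n k : vfield M.
Hypothesis F : null_frame g N V m p n k.

Let vm : vector_field V m. Proof. exact: nf_m F. Qed.
Let vp : vector_field V p. Proof. exact: nf_p F. Qed.
Let vn : vector_field V n. Proof. exact: nf_n F. Qed.
Let vk : vector_field V k. Proof. exact: nf_k F. Qed.
Let tm x : V x -> tangent x (m x). Proof. exact: vm.1. Qed.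
Let tp x : V x -> tangent x (p x). Proof. exact: vp.1. Qed.
Let tn x : V x -> tangent x (n x). Proof. exact: vn.1. Qed.
Let tk x : V x -> tangent x (k x). Proof. exact: vk.1. Qed.

Lemma N_lin x (a : C) u v : V x -> N x u -> N x v -> N x (a *: u + v).
Proof.
by move=> Vx; rewrite (nf_N F Vx); exact: span2_lin.
Qed.

Lemma section_m : section N V m.
Proof.
split=> // x Vx; rewrite (nf_N F Vx); exists 1, 0.
by rewrite scale1r scale0r addr0.
Qed.

Lemma section_k : section N V k.
Proof.
split=> // x Vx; rewrite (nf_N F Vx); exists 0, 1.
by rewrite scale1r scale0r add0r.
Qed.

(** A vector of [N] is orthogonal to [m] and [k], which kills its components along [p] and [n]. *)
Lemma N_expand x u : V x -> tangent x u -> N x u ->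
  u = g x u (p x) *: m x + g x u (n x) *: k x.
Proof.
move=> Vx tu Nu; rewrite {1}(null_frame_expand hg F Vx tu).
rewrite (hnull Nu (section_m.2 _ Vx)) (hnull Nu (section_k.2 _ Vx)).
by rewrite !scale0r !add0r.
Qed.

(** In [weyl_levi_civita] the term with [g(X, Y)] vanishes because [N] is totally null. Comparing
    products with test fields avoids constructing the vector dual to [b]. *)
Lemma characteristicE X Y x : section N V X -> section N V Y -> V x ->
  cnabla X Y x = b x (X x) *: Y x + (b x (Y x) *: X x + nabla X Y x).
Proof.
move=> sX sY Vx; have [vX NX] := sX; have [vY NY] := sY.
have tX := vX.1 _ Vx; have tY := vY.1 _ Vx.
have tL := (vector_field_nabla lc oV vX vY).1 _ Vx.
have tW := (vector_field_weyl vX vY).1 _ Vx.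
have tR := tangent_lin (b x (Y x)) tX tL.
rewrite hcW//; apply: (null_frame_nondeg hg F Vx) => //.
  exact: tangent_lin.
move=> Z vZ; have tZ := vZ.1 _ Vx.
rewrite !(metric_linl hg)// weyl_levi_civita//.
by rewrite (hnull (NX _ Vx) (NY _ Vx)); ring.
Qed.

Lemma section_characteristic X Y : section N V X -> section N V Y ->
  section N V (cnabla X Y).
Proof. by move=> sX sY; have [cs _ _ _] := hc oV (fun _ _ => I); exact: cs. Qed.

(** By [characteristicE], [nabla X Y] differs from a section of [N] by multiples of [X] and [Y]. *)
Lemma N_nabla X Y x : section N V X -> section N V Y -> V x ->
  N x (nabla X Y x).
Proof.
move=> sX sY Vx; have := characteristicE sX sY Vx.
have Nc := (section_characteristic sX sY).2 _ Vx => e.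
have -> : nabla X Y x = - b x (X x) *: Y x + (- b x (Y x) *: X x + cnabla X Y x).
  by rewrite e; apply/funext => f; rewrite !tvecE; ring.
by apply: N_lin => //; [exact: sY.2|apply: N_lin => //; exact: sX.2].
Qed.

(** The Weyl derivative of [m] along any [Y] stays in [N], so it is orthogonal to [k]. Taking
    [Y = n] and [Y = p] recovers [B(m) = 2 Gamma_143] and [B(k) = -2 Gamma_142]. *)
Lemma ip_nabla_mk Y x : vector_field V Y -> V x ->
  g x (nabla Y m x) (k x)
  = b x (k x) * g x (Y x) (m x) - b x (m x) * g x (Y x) (k x).
Proof.
move=> vY Vx; have := weyl_levi_civita vY vm vk Vx.
have [_ NW] := hpres oV (fun _ => id) section_m vY.
rewrite (hnull (NW _ Vx) (section_k.2 _ Vx)) (nf_mk F)//.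
by move=> /esym/transfer_eq; apply; ring.
Qed.

Lemma ip_nabla_km Y x : vector_field V Y -> V x ->
  g x (nabla Y k x) (m x) = - g x (nabla Y m x) (k x).
Proof.
move=> vY Vx; rewrite (ip_nabla_cst hg lc oV vY vk vm _ Vx (c := 0)).
  rewrite (metricC hg (tk Vx))//.
  exact: (vector_field_nabla lc oV vY vm).1.
by move=> y Vy; rewrite (metricC hg (tk Vy) (tm Vy)) (nf_mk F).
Qed.

Lemma nabla_linE X Y Z f x : vector_field V X -> vector_field V Y ->
  vector_field V Z -> smooth V f -> V x ->
  nabla X (fun y => f y *: Y y + Z y) x
  = X x f *: Y x + f x *: nabla X Y x + nabla X Z x.
Proof.
have [cn _ _] := lc => vX vY vZ sf Vx; have [_ _ _ lei] := cn V oV (fun _ _ => I).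
by rewrite lei//; exact: section_tangent.
Qed.

Local Notation f := (fun y => b y (m y)).
Local Notation h := (fun y => b y (k y)).

(** One computation covering [R_4121], [R_4131] and [R_4134]: [X] is [m] or [k], [Y] is [p] or [n].
    Only derivatives of [b(m)] and [b(k)] along [X] appear, since [nabla X m] lies in [N] and the
    products [c1], [c4] are constant. *)
Lemma riem_null X Y (c1 c4 : C) x : section N V X -> vector_field V Y ->
  (forall y, V y -> g y (Y y) (m y) = c1) ->
  (forall y, V y -> g y (Y y) (k y) = c4) -> V x ->
  let a1 := g x (nabla X m x) (p x) in let a4 := g x (nabla X m x) (n x) in
  let d1 := g x (nabla X k x) (p x) in let d4 := g x (nabla X k x) (n x) in
  riem g nabla k m Y X x = (a1 + d4) * (h x * c1 - f x * c4)
    - (c1 * X x h - c4 * X x f)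
    - (h x * (g x (nabla Y X x) (m x) + c1 * a1 + c4 * a4)
       - f x * (g x (nabla Y X x) (k x) + c1 * d1 + c4 * d4)).
Proof.
move=> sX vY Ym Yk Vx a1 a4 d1 d4; have [vX NX] := sX.
have vL := vector_field_nabla lc oV.
have tL X' Y' : vector_field V X' -> vector_field V Y' -> tangent x (nabla X' Y' x).
  by move=> vX' vY'; exact: (vL _ _ vX' vY').1.
have act_eq X' f1 f2 : vector_field V X' -> smooth V f1 ->
    (forall y, V y -> f1 y = f2 y) -> X' x f1 = X' x f2.
  by move=> vX'; exact: tangent_eq oV Vx (vX'.1 _ Vx).
have sip := smooth_ip hg oV.
have w0 : Y x (ip g (nabla X m) k) = 0.
  rewrite (act_eq _ _ (fun=> 0) vY (sip _ _ (vL _ _ vX vm) vk)).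
    exact: tangent_cst (vY.1 _ Vx).
  by move=> y Vy; apply: hnull; [exact: N_nabla section_m Vy|exact: section_k.2].
have w1 : X x (ip g (nabla Y m) k) = c1 * X x h - c4 * X x f.
  have sh := smooth_half_form vk; have sf := smooth_half_form vm.
  have tX := vX.1 _ Vx; have [_ _ Xl _] := tX.
  have sa e : smooth V e -> smooth_at x e by exact: smooth_at_open.
  (* The trailing [+ 0] gives both nested sums the shape [a * f + h] of the linearity clause of
     [tangent]. *)
  rewrite (act_eq _ _ (fun y => c1 * h y + (- c4 * f y + 0)) vX
    (sip _ _ (vL _ _ vY vm) vk)).
    have s0 := smooth_cst V (0 : C).
    have sc a e : smooth V e -> smooth V (fun y => a * e y).
      by move=> se; exact: smoothM (smooth_cst V a) se.
    rewrite (Xl c1 h)//; try apply: sa => //; last exact: smoothD (sc _ _ sf) s0.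
    by rewrite (Xl (- c4) f) ?(tangent_cst _ tX); try exact: sa; ring.
  by move=> y Vy; rewrite /ip ip_nabla_mk// Ym// Yk//; ring.
(* Metric compatibility expresses each second covariant derivative of [m], paired with [k], through
   a known derivative and a product of first covariant derivatives; the expansions [Em] and [Ek]
   then make those products explicit. *)
have e0 := act_ip lc oV vY (vL _ _ vX vm) vk Vx; rewrite w0 in e0.
have e1 := act_ip lc oV vX (vL _ _ vY vm) vk Vx; rewrite w1 in e1.
have Em : nabla X m x = a1 *: m x + a4 *: k x.
  apply: N_expand => //; first exact: tL; exact: N_nabla section_m Vx.
have Ek : nabla X k x = d1 *: m x + d4 *: k x.
  apply: N_expand => //; first exact: tL; exact: N_nabla section_k Vx.
have vB := vector_field_bracket lc oV vY vX.
have tB : tangent x (bracket Y X x) by exact: vB.1.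
have tK := tk Vx; have tM := tm Vx; have tY := vY.1 _ Vx.
have t1 := tL _ _ vY (vL _ _ vX vm); have t2 := tL _ _ vX (vL _ _ vY vm).
have t3 := tL _ _ vB vm; have t4 := tL _ _ vY vk; have t5 := tL _ _ vY vm.
have t6 := tL _ _ vY vX; have t7 := tL _ _ vX vY.
rewrite /riem /ip /curvature (metricC hg tK); last first.
  by apply: tangentB => //; exact: tangentB.
rewrite (metricBl hg (tangentB t1 t2) t3 tK) (metricBl hg t1 t2 tK).
rewrite (ip_nabla_mk vB Vx) (bracket_nabla lc oV vY vX Vx).
rewrite (metricBl hg t6 t7 tM) (metricBl hg t6 t7 tK).
rewrite (ip_nabla_cst hg lc oV vX vY vm Ym Vx) (ip_nabla_cst hg lc oV vX vY vk Yk Vx).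
have bil A a d : tangent x A ->
    g x A (a *: m x + d *: k x) = a * g x A (m x) + d * g x A (k x).
  move=> tA; rewrite (metric_linr hg)//; last exact: tangentZ.
  by rewrite (metricC hg tA (tangentZ d tK)) (metricZl hg)// (metricC hg tK tA).
have ta a d : tangent x (a *: m x + d *: k x).
  by apply: tangent_lin => //; exact: tangentZ.
move: e0 e1; rewrite /ip Em Ek (metricC hg (ta _ _) t4) !bil// Ym// Yk// => e0 e1.
rewrite (ip_nabla_null hg lc oV vY vk (nf_kk F) Vx) (ip_nabla_km vY Vx) in e0.
rewrite (ip_nabla_null hg lc oV vY vm (nf_mm F) Vx) in e1.
rewrite (ip_nabla_mk vY Vx) Ym// Yk// in e0 e1.
have -> : g x (nabla Y (nabla X m) x) (k x) = a1 * (h x * c1 - f x * c4).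
  by move: e0 => /esym/transfer_eq; apply; ring.
have -> : g x (nabla X (nabla Y m) x) (k x)
    = c1 * X x h - c4 * X x f - d4 * (h x * c1 - f x * c4).
  by move: e1 => /esym/transfer_eq; apply; ring.
by ring.
Qed.

(** The curvature equals the Levi-Civita one plus [cm *: m + ck *: k]. Substituting the three
    instances of [riem_null] makes the component along [k] cancel and gives the stated multiple of
    [m]. *)
Lemma curvature_characteristic_m x : V x ->
  curvature cnabla m k m x
  = (2 * (riem g nabla m k n k x + riem g nabla p m m k x)) *: m x.
Proof.
move=> Vx; have sm := section_m; have sk := section_k.
have sB : section N V (bracket m k) by exact: hint.
have sh := smooth_half_form vk; have sf := smooth_half_form vm.
have skm := section_characteristic sk sm; have smm := section_characteristic sm sm.
have vL := vector_field_nabla lc oV.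
have tL X' Y' : vector_field V X' -> vector_field V Y' -> tangent x (nabla X' Y' x).
  by move=> vX' vY'; exact: (vL _ _ vX' vY').1.
have tM := tm Vx; have tK := tk Vx; have tN := tn Vx; have tP := tp Vx.
have exp X Y : section N V X -> section N V Y -> nabla X Y x =
    g x (nabla X Y x) (p x) *: m x + g x (nabla X Y x) (n x) *: k x.
  move=> sX sY; apply: N_expand => //; last exact: N_nabla.
  by apply: tL; [exact: sX.1|exact: sY.1].
have bil a d : b x (a *: m x + d *: k x) = a * f x + d * h x.
  rewrite half_form_lin//; last exact: tangentZ.
  rewrite -[d *: k x]addr0 half_form_lin//; last exact: tangent0.
  have -> : b x 0 = 0.
    by have := half_formB Vx tK tK; rewrite !subrr.
  by rewrite addr0.
have pm1 y : V y -> g y (p y) (m y) = 1.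
  by move=> Vy; rewrite (metricC hg (tp Vy) (tm Vy)) (nf_mp F).
have nm0 y : V y -> g y (n y) (m y) = 0.
  by move=> Vy; rewrite (metricC hg (tn Vy) (tm Vy)) (nf_mn F).
have R4121 := riem_null sm vp pm1 (nf_pk F) Vx.
have R4131 := riem_null sm vn nm0 (nf_nk F) Vx.
have R4134 := riem_null sk vn nm0 (nf_nk F) Vx.
rewrite /= (ip_nabla_null hg lc oV vp vm (nf_mm F) Vx) (ip_nabla_mk vp Vx)
  (pm1 _ Vx) (nf_pk F Vx) in R4121.
rewrite /= (ip_nabla_null hg lc oV vn vm (nf_mm F) Vx) (ip_nabla_mk vn Vx)
  (nm0 _ Vx) (nf_nk F Vx) in R4131.
rewrite /= (ip_nabla_null hg lc oV vn vk (nf_kk F) Vx) (ip_nabla_km vn Vx)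
  (ip_nabla_mk vn Vx) (nm0 _ Vx) (nf_nk F Vx) in R4134.
have P1 : riem g nabla p m m k x = - riem g nabla k m p m x.
  rewrite (riem_pair hg lc oV vp vm vm vk Vx).
  exact: (riem_skew hg lc oV vp vm vm vk Vx).
have P2 : riem g nabla n m m k x = - riem g nabla k m n m x.
  rewrite (riem_pair hg lc oV vn vm vm vk Vx).
  exact: (riem_skew hg lc oV vn vm vm vk Vx).
have P3 : riem g nabla m k n k x = - riem g nabla k m n k x.
  exact: (riem_skew hg lc oV vn vk vm vk Vx).
(* [characteristicE] holds on all of [V], so it may be substituted under the outer derivative, which
   then also falls on the coefficients [b(m)] and [b(k)]. *)
have E1 : nabla m (cnabla k m) x
    = m x h *: m x + h x *: nabla m m x
      + (m x f *: k x + f x *: nabla m k x + nabla m (nabla k m) x).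
  have vkm := vL _ _ vk vm.
  rewrite -(nabla_linE vm vk vkm sf Vx) -(nabla_linE vm vm _ sh Vx).
    apply: (nabla_eq lc oV vm skm.1 Vx) => y Vy; exact: characteristicE.
  exact: vector_field_lin.
have E2 : nabla k (cnabla m m) x
    = k x f *: m x + f x *: nabla k m x
      + (k x f *: m x + f x *: nabla k m x + nabla k (nabla m m) x).
  have vmm := vL _ _ vm vm.
  rewrite -(nabla_linE vk vm vmm sf Vx) -(nabla_linE vk vm _ sf Vx).
    apply: (nabla_eq lc oV vk smm.1 Vx) => y Vy; exact: characteristicE.
  exact: vector_field_lin.
have Lie := bracket_nabla lc oV vm vk Vx.
pose L a d := a *: m x + d *: k x.
have tLm := tangent_curvature lc oV vm vk vm Vx.
(* The letters name the direction and the differentiated field; the digits 1 and 4 mark the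
   components along [m] and [k]. *)
set mm1 := g x (nabla m m x) (p x) in R4121 R4131 R4134.
set mm4 := g x (nabla m m x) (n x) in R4121 R4131 R4134.
set mk1 := g x (nabla m k x) (p x) in R4121 R4131 R4134.
set mk4 := g x (nabla m k x) (n x) in R4121 R4131 R4134.
set km1 := g x (nabla k m x) (p x) in R4121 R4131 R4134.
set km4 := g x (nabla k m x) (n x) in R4121 R4131 R4134.
set kk1 := g x (nabla k k x) (p x) in R4121 R4131 R4134.
set kk4 := g x (nabla k k x) (n x) in R4121 R4131 R4134.
have Emm : nabla m m x = L mm1 mm4 by exact: exp.
have Emk : nabla m k x = L mk1 mk4 by exact: exp.
have Ekm : nabla k m x = L km1 km4 by exact: exp.
have Ckm : cnabla k m x = L (km1 + h x) (km4 + f x).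
  rewrite (characteristicE sk sm Vx) Ekm; apply/funext => phi.
  by rewrite /L !tvecE; ring.
have Cmm : cnabla m m x = L (mm1 + 2 * f x) mm4.
  rewrite (characteristicE sm sm Vx) Emm; apply/funext => phi.
  by rewrite /L !tvecE; ring.
have EB : bracket m k x = L (mk1 - km1) (mk4 - km4).
  by rewrite Lie Emk Ekm; apply/funext => phi; rewrite /L !tvecE; ring.
pose cm := m x h - 2 * k x f + f x * h x + (km1 * f x + km4 * h x)
  - ((mk1 - km1) * f x + (mk4 - km4) * h x).
pose ck := m x f - f x ^+ 2 - (mm1 * f x + mm4 * h x).
have EC : curvature cnabla m k m x = curvature nabla m k m x + L cm ck.
  rewrite /curvature (characteristicE sm skm Vx) (characteristicE sk smm Vx).
  rewrite (characteristicE sB sm Vx) E1 E2 Ckm Cmm EB Emm Emk Ekm !bil.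
  by apply/funext => phi; rewrite /L !tvecE /cm /ck; ring.
have tL0 a d : tangent x (L a d) by apply: tangent_lin => //; exact: tangentZ.
have tC : tangent x (curvature cnabla m k m x) by rewrite EC; exact: tangentD.
(* All three terms of the curvature are sections of [N], the last by integrability. Hence pairing
   with [p] and [n] determines the curvature. *)
have NC : N x (curvature cnabla m k m x).
  have s1 := (section_characteristic sm skm).2 _ Vx.
  have s2 := (section_characteristic sk smm).2 _ Vx.
  have s3 := (section_characteristic sB sm).2 _ Vx.
  have := N_lin (-1) Vx s3 (N_lin (-1) Vx s2 s1).
  by congr (N x _); apply/funext => phi; rewrite /curvature !tvecE; ring.
rewrite (N_expand Vx tC NC) EC (metricDl hg tLm (tL0 cm ck) tP)
  (metricDl hg tLm (tL0 cm ck) tN).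
have -> : g x (L cm ck) (p x) = cm.
  rewrite (metric_linl hg)//; last exact: tangentZ.
  by rewrite (metricZl hg)// (metricC hg tK tP) (nf_pk F)// (nf_mp F)//; ring.
have -> : g x (L cm ck) (n x) = ck.
  rewrite (metric_linl hg)//; last exact: tangentZ.
  by rewrite (metricZl hg)// (metricC hg tK tN) (nf_nk F)// (nf_mn F)//; ring.
rewrite (metricC hg tLm tP) (metricC hg tLm tN).
have -> : g x (p x) (curvature nabla m k m x) = riem g nabla p m m k x by [].
have -> : g x (n x) (curvature nabla m k m x) = riem g nabla n m m k x by [].
rewrite P3 P2 P1 R4121 R4131 R4134 /cm /ck.
by apply/funext => phi; rewrite !tvecE; ring.
Qed.

End Characteristic.

(** * Restriction of Weyl data to smaller open sets *)

Section Restriction.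
Context {R : realType} {M : manifold4 R}.
Variables (U V : set M) (VU : V `<=` U).

Lemma one_form_sub B : one_form U B -> one_form V B.
Proof.
move=> [Bl Bs]; split=> [x a u v /VU|V' X oV' V'V]; first exact: Bl.
by apply: Bs => //; exact: subset_trans VU.
Qed.

Lemma weyl_connection_sub g B nab :
  weyl_connection g U B nab -> weyl_connection g V B nab.
Proof.
move=> [cn tf dg]; split=> V' => [oV' V'V|X Y oV' V'V|X Y Z oV' V'V].
- by apply: cn => //; exact: subset_trans VU.
- by apply: tf => //; exact: subset_trans VU.
- by apply: dg => //; exact: subset_trans VU.
Qed.

Lemma preserves_sub N nab : preserves U N nab -> preserves V N nab.
Proof.
by move=> pN V' X Y oV' V'V; apply: pN => //; exact: subset_trans VU.
Qed.

End Restriction.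

Theorem theorem6p2 (R : realType) (M : manifold4 R)
    (g : bilinear_form M) (hg : metric g)
    (N : M -> set (tvec M)) (hN : rank2_subbundle N)
    (hnull : totally_null g N) (hint : integrable_field N)
    (cnabla : vfield M -> vfield M -> vfield M)
    (hcnabla : characteristic_connection g N cnabla)
    (nabla : vfield M -> vfield M -> vfield M) (hnabla : levi_civita g nabla)
    (U : set M) (hU : open U) (m p n k : vfield M)
    (hframe : adapted_null_frame g N U m p n k) :
  let Psi1 := weyl g nabla (frame4 m p n k) m k n k in
  (forall (V : set M) (X Y : vfield M), open V ->
     section N V X -> section N V Y ->
     forall x, V x -> torsion cnabla X Y x = 0) /\
  (forall x, U x ->
     curvature cnabla m k m x = (4 * Psi1 x) *: m x /\
     curvature cnabla m k k x = (4 * Psi1 x) *: k x).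
Proof.
have [hc hloc] := hcnabla; split=> [V X Y oV sX sY x Vx|x Ux].
  (* Near [x] the torsion is that of a local Weyl connection, which vanishes on all vector
     fields. *)
  have [U' [B [nW [[oU' U'x] _ [_ tf _] _ agree]]]] := hloc x.
  have oW := openI oV oU'; have Wx : (V `&` U') x by [].
  have sX' := section_sub oW (@subIsetl _ _ _) sX.
  have sY' := section_sub oW (@subIsetl _ _ _) sY.
  rewrite /torsion !(agree _ _ _ oW (@subIsetr _ _ _))//.
  apply: (tf _ _ _ oW (@subIsetr _ _ _) _ _ _ Wx); apply: section_tangent.
    exact: sX'.1.
  exact: sY'.1.
have [U' [B [nW [[oU' U'x] hB hW hp agree]]]] := hloc x.
have oV := openI hU oU'; have Vx : (U `&` U') x by [].
have VU' : U `&` U' `<=` U' by [].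
have F := adapted_null_frameP oV (@subIsetl _ U U') hframe.
(* The frame is left free so that the result applies both to [(m, p, n, k)] and to the exchanged
   frame [(k, n, p, m)]. *)
have key m' p' n' k' := @curvature_characteristic_m _ _ _ hg _ hnabla _ hnull hint
  _ oV _ _ (one_form_sub VU' hB) (weyl_connection_sub VU' hW)
  (preserves_sub VU' hp) _ hc (fun X Y => agree _ X Y oV VU') m' p' n' k'.
have psi : 4 * weyl g nabla (frame4 m p n k) m k n k x
    = 2 * (riem g nabla m k n k x + riem g nabla p m m k x).
  by rewrite -(weyl_riem_null_frame hg hnabla oV F Vx); ring.
have [vm vp vn vk] := And4 (nf_m F) (nf_p F) (nf_n F) (nf_k F).
rewrite psi; split; first exact: key F x Vx.
have skm : section N (U `&` U') (bracket m k).
  by apply: hint => //; [exact: section_m F|exact: section_k F].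
(* The exchanged frame computes the curvature on [(k, m)] rather than [(m, k)], which costs a sign.
   The Riemann components [R_4121] and [R_3441] that appear are [-R_2114] and [-R_1434], so the two
   signs compensate. *)
rewrite (curvatureC hc _ oV (fun _ _ => I) Vx skm (section_k F)); last first.
  by move=> *; exact: rank2_subbundle_lin.
rewrite (key _ _ _ _ (null_frame_swap hg F) x Vx).
rewrite (riem_skew hg hnabla oV vp vm vk vm Vx).
rewrite (riem_pair hg hnabla oV vm vk vp vm Vx).
rewrite (riem_pair hg hnabla oV vn vk vk vm Vx).
rewrite (riem_skew hg hnabla oV vn vk vk vm Vx).
by rewrite -scaleNr; congr (_ *: _); ring.
Qed.
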